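(* Let $q$ and $x$ be complex numbers with $|q|<1$, and let $(a_k)_{k=-\infty}^{\infty}$ be a sequence of complex numbers such that the double series below converge absolutely (and $(-x;q)_j\neq 0$ for all $j\ge 0$). Then $$\sum_{i,j\geq 0} \frac{a_{i-j}\,q^{\frac{j(j-1)}{2}}x^j}{(q;q)_i(q;q)_j} =(-x;q)_\infty \sum_{i,j\geq 0} \frac{a_{i-j}\,q^{\frac{j(j-1)}{2}+ij} x^j}{(q;q)_i(q;q)_j(-x;q)_j}.$$
   Context: Standard $q$-Pochhammer notation: $(a;q)_0=1$, $(a;q)_n=\prod_{k=0}^{n-1}(1-aq^k)$, $(a;q)_\infty=\prod_{k=0}^{\infty}(1-aq^k)$, and $(a_1,\dots,a_m;q)_n=(a_1;q)_n\cdots(a_m;q)_n$ for $n\in\mathbb{N}\cup\{\infty\}$. *)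

(* Defs.v *)
From mathcomp Require Import all_boot all_order all_algebra.
From mathcomp Require Import all_classical all_reals all_analysis.
From mathcomp Require Export complex.
Export numFieldNormedType.Exports.
Import Order.TTheory GRing.Theory Num.Theory.
Set Implicit Arguments. Unset Strict Implicit. Unset Printing Implicit Defensive.
Local Open Scope ring_scope.
Local Open Scope classical_set_scope.

Definition qpoch {K : comPzRingType} (a q : K) (n : nat) : K :=
  \prod_(k < n) (1 - a * q ^+ k).

Definition qpoch_inf {K : numFieldType} (a q : K) : K :=
  lim ((fun n => qpoch a q n) @ \oo).

(* absolute convergence of a double series over (i,j) in N x N:
   the partial sums of |f i j| over finite squares (hence over all finite
   subsets) are bounded *)
Definition abs_summable2 {K : numFieldType} (f : nat -> nat -> K) : Prop :=
  exists M : K, forall N : nat, \sum_(i < N) \sum_(j < N) `|f i j| <= M.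

(* value of the double series sum_{i,j>=0} f i j (limit of square partial
   sums; for absolutely convergent families this is the sum in any order) *)
Definition dsum2 {K : numFieldType} (f : nat -> nat -> K) : K :=
  lim ((fun N : nat => \sum_(i < N) \sum_(j < N) f i j) @ \oo).

(* Main.v *)
(* For every N there is an identity between finite sums, obtained from the claim
   by inserting the weight (q)_N / (q)_(N-j) on both sides, replacing the
   infinite product by (-x)_N, and restricting to j <= N, i <= j + N, a region
   that is a union of initial segments of diagonals i - j = const.  Comparing
   coefficients of x^m on each diagonal, it is Rothe's q-binomial theorem
   combined with the q-Vandermonde sum
     1/((q)_I (q)_J) = sum_k q^((I-k)(J-k)) / ((q)_(I-k) (q)_(J-k) (q)_k).
   The weights are bounded and tend to 1, so by dominated convergence, with the
   two absolutely convergent series as majorants, the identity passes to the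
   limit N -> oo. *)
Require Import Defs.
From mathcomp Require Import all_boot all_order all_algebra.
From mathcomp Require Import all_classical all_reals all_analysis.
From mathcomp Require Import complex.
From mathcomp Require Import ring zify lra.
Import Order.TTheory GRing.Theory Num.Theory.
Local Open Scope ring_scope.

(** * Finite q-Pochhammer symbols and q-binomial coefficients *)

Lemma qpochS {K : comPzRingType} (a q : K) n :
  qpoch a q n.+1 = qpoch a q n * (1 - a * q ^+ n).
Proof. exact: big_ord_recr. Qed.

Lemma qpochD {K : comPzRingType} (a q : K) m n :
  qpoch a q (m + n) = qpoch a q m * qpoch (a * q ^+ m) q n.
Proof.
elim: n => [|n IHn]; first by rewrite addn0 [qpoch _ _ 0]big_ord0 mulr1.
by rewrite addnS !qpochS IHn exprD !mulrA.
Qed.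

(* The exponent is truncated only where qbinom q n' k' = 0. *)
Fixpoint qbinom {K : pzRingType} (q : K) (n k : nat) : K :=
  match n, k with
  | _, 0 => 1
  | 0, _.+1 => 0
  | n'.+1, k'.+1 => q ^+ (n' - k') * qbinom q n' k' + qbinom q n' k
  end.

Lemma qbinom0 {K : pzRingType} (q : K) n : qbinom q n 0 = 1.
Proof. by case: n. Qed.

Lemma qbinom_small {K : pzRingType} (q : K) n k : (n < k)%N -> qbinom q n k = 0.
Proof.
elim: n k => [|n IHn] [|k] //= lt_nk.
by rewrite !IHn ?mulr0 ?addr0 // ltnW.
Qed.

(** The factorial formula in division-free form. The q-Pascal rule reduces it to 1 - q^(n+1) =
    q^(n-k) (1 - q^(k+1)) + (1 - q^(n-k)). *)
Lemma qbinom_qpoch {K : comPzRingType} (q : K) n k : (k <= n)%N ->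
  qbinom q n k * (qpoch q q k * qpoch q q (n - k)) = qpoch q q n.
Proof.
elim: n k => [|n IHn] [|k]; rewrite ?subn0 /qpoch ?big_ord0 -?/(qpoch _ _ _) //=;
  try by rewrite ?mul1r ?mulr1.
rewrite ltnS subSS => le_kn; rewrite !qpochS.
have [lt_kn|le_nk] := ltnP k n; last first.
  have -> : k = n by lia.
  rewrite (qbinom_small _ _ _ (ltnSn n)) addr0.
  by rewrite -[in RHS](IHn n (leqnn n)) subnn; ring.
have h1 := IHn _ le_kn; have h2 := IHn _ lt_kn.
rewrite qpochS in h2; rewrite -(subnSK lt_kn) [qpoch _ _ (_ - _).+1]qpochS in h1 *.
have -> : q * q ^+ n = q * q ^+ k * (q * q ^+ (n - k.+1)).
  rewrite -[in LHS](subnK lt_kn) exprD exprS; ring.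
rewrite exprS.
set X := q ^+ k in h1 h2 *; set Y := q ^+ (n - k.+1) in h1 h2 *.
transitivity (q * Y * (1 - q * X) * qpoch q q n + (1 - q * Y) * qpoch q q n).
  by rewrite -{1}h1 -h2; ring.
by ring.
Qed.

Lemma binD2 m n : 'C(m + n, 2) = ('C(m, 2) + 'C(n, 2) + m * n)%N.
Proof.
elim: n => [|n IHn]; first by rewrite bin0n muln0 !addn0.
by rewrite addnS !binS !bin1 IHn mulnS; lia.
Qed.

(* Rothe's finite q-binomial theorem *)
Lemma qpoch_sum {K : comPzRingType} (q y : K) n :
  qpoch (- y) q n = \sum_(k < n.+1) qbinom q n k * q ^+ 'C(k, 2) * y ^+ k.
Proof.
elim: n => [|n IHn]; first by rewrite /qpoch big_ord0 big_ord1 /= !mulr1.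
rewrite qpochS IHn mulNr opprK mulrDr mulr1.
rewrite [RHS]big_ord_recl [in X in X + _]big_ord_recl !qbinom0 -addrA.
congr (_ + _).
transitivity (\sum_(k < n.+1) (qbinom q n k.+1 * q ^+ 'C(k.+1, 2) * y ^+ k.+1)
   + \sum_(k < n.+1) (qbinom q n k * q ^+ 'C(k, 2) * y ^+ k) * (y * q ^+ n)).
  rewrite -mulr_suml; congr (_ + _).
  by rewrite big_ord_recr /= (qbinom_small _ _ _ (ltnSn n)) !mul0r addr0.
rewrite -big_split; apply: eq_bigr => k _ /=.
rewrite /bump /= add1n binS bin1 !exprD exprS.
have -> : q ^+ n = q ^+ (n - k) * q ^+ k by rewrite -exprD subnK // -ltnS.
by ring.
Qed.

(** * The q-Vandermonde sum *)

Section QField.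
Context {K : fieldType} (q : K).
Hypothesis q_neq0 : forall n, qpoch q q n != 0.

(** Induction on [J]. The q-Pascal rule splits the sum for [J.+1] into [f] and, with k lowered by
    one, [g]; then [f k + g k] is the k-th term for [J], because q^(I-k) + (1 - q^(I-k)) = 1. The
    guards on k stand for 1/(q)_m = 0 at negative m, which truncated subtraction would miss. *)
Lemma qVandermonde_binom I J :
  \sum_(k < J.+1 | (k <= I)%N)
     qbinom q J k * q ^+ ((I - k) * (J - k)) / qpoch q q (I - k)
  = (qpoch q q I)^-1.
Proof.
elim: J => [|J IHJ].
  by rewrite big_mkcond big_ord1 /= subn0 muln0 !mul1r.
rewrite -IHJ.
pose f k := if (k <= I)%N then
  qbinom q J k * q ^+ ((I - k) * (J.+1 - k)) / qpoch q q (I - k) else 0.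
pose g k := if (k.+1 <= I)%N then qbinom q J k * q ^+ (J - k) *
  q ^+ ((I - k.+1) * (J - k)) / qpoch q q (I - k.+1) else 0.
transitivity (\sum_(k < J.+1) f k + \sum_(k < J.+1) g k).
  have -> : \sum_(k < J.+1) f k = f 0 + \sum_(k < J.+1) f k.+1.
    rewrite big_ord_recl; congr (_ + _).
    rewrite [RHS]big_ord_recr /=.
    suff -> : f J.+1 = 0 by rewrite addr0.
    by rewrite /f qbinom_small // !mul0r if_same.
  rewrite -addrA -big_split big_mkcond big_ord_recl; congr (_ + _).
    by rewrite /f /= !qbinom0.
  apply: eq_bigr => k _; rewrite /f /g /= /bump add1n.
  case: ifP => _; last by rewrite addr0.
  rewrite subSS; ring.
rewrite -big_split [RHS]big_mkcond; apply: eq_bigr => k _ /=.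
rewrite /f /g; have le_kJ : (k <= J)%N by rewrite -ltnS.
have [lt_kI|] := ltnP k I; last first.
  rewrite leq_eqVlt => /predU1P[<-|lt_Ik]; last by rewrite leqNgt lt_Ik addr0.
  by rewrite leqnn subnn !mul0n addr0.
rewrite (ltnW lt_kI) subSn // mulnS -(subnSK lt_kI) qpochS mulSn.
have := q_neq0 (I - k.+1); have := q_neq0 (I - k.+1).+1; rewrite qpochS.
rewrite mulf_eq0 negb_or => /andP[_ h1] h2.
rewrite !exprD exprS; field.
by rewrite h1 h2.
Qed.

Lemma qVandermonde I J :
  \sum_(k < J.+1 | (k <= I)%N) q ^+ ((I - k) * (J - k)) /
     (qpoch q q (I - k) * qpoch q q (J - k) * qpoch q q k)
  = (qpoch q q I * qpoch q q J)^-1.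
Proof.
rewrite invfM -(qVandermonde_binom I J) mulr_suml; apply: eq_bigr => k _.
have le_kJ : (k <= J)%N by rewrite -ltnS.
rewrite -(qbinom_qpoch _ _ _ le_kJ).
have := q_neq0 J; rewrite -(qbinom_qpoch _ _ _ le_kJ) !mulf_eq0 !negb_or.
move=> /and3P[b0 k0 Jk0]; field.
by rewrite b0 k0 Jk0 q_neq0.
Qed.

End QField.

(** * The finite identity on the wedge *)

(** Substitution i = I - k, j = J - k. Since I - J = i - j, the condition I <= J + N becomes i <= j
    + N, while J <= N becomes k <= N - j. *)
Lemma sum_wedge_shift {V : nmodType} (F : nat -> nat -> nat -> V) N :
  \sum_(J < N.+1) \sum_(I < (J + N).+1) \sum_(k < J.+1 | (k <= I)%N)
    F (I - k)%N (J - k)%N k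
  = \sum_(j < N.+1) \sum_(i < (j + N).+1) \sum_(k < (N - j).+1) F i j k.
Proof.
pose G k j := \sum_(0 <= i < (j + N).+1) F i j k.
have shift n (f : nat -> V) k : \sum_(0 <= i < n | (k <= i)%N) f (i - k)%N
    = \sum_(0 <= i < n - k) f i.
  rewrite -(big_nat_widenl k 0 n xpredT (fun i => f (i - k)%N) (leq0n k)).
  rewrite -{1}(add0n k) big_addn; apply: eq_bigr => i _; by rewrite addnK.
(* With J and k fixed, shifting I by k makes the inner sum depend only on k and J - k. *)
transitivity (\sum_(0 <= J < N.+1) \sum_(0 <= k < N.+1 | (k <= J)%N)
    G k (J - k)%N).
  rewrite big_mkord; apply: eq_bigr => -[J /= ltJ] _.
  under eq_bigr do rewrite -(big_mkord (fun k => k <= _)%N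
    (fun k => F (_ - k)%N (J - k)%N k)).
  rewrite -(big_mkord xpredT (fun I => \sum_(0 <= k < J.+1 | (k <= I)%N)
     F (I - k)%N (J - k)%N k)).
  rewrite (exchange_big_dep_nat xpredT) //= (big_nat_widen _ _ N.+1) //.
  rewrite big_mkcond [RHS]big_mkcond; apply: eq_bigr => k _ /=.
  rewrite ltnS; case: ifP => // le_kJ.
  rewrite (shift _ (fun i => F i (J - k)%N k)) /G; congr (bigop.body _ _ _).
  by congr (index_iota _ _); lia.
rewrite (exchange_big_dep_nat xpredT) //=.
under eq_bigr do rewrite (shift _ (G _)).
transitivity (\sum_(0 <= k < N.+1) \sum_(0 <= j < N.+1 | (j + k < N.+1)%N)
   G k j).
  apply: eq_big_nat => k /andP[_ lt_kN].
  rewrite (big_nat_widen _ _ N.+1) ?leq_subr //.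
  by apply: eq_bigl => j /=; lia.
rewrite (exchange_big_dep_nat xpredT) //= big_mkord.
apply: eq_bigr => -[j /= lt_jN] _.
rewrite -[RHS](big_mkord xpredT (fun i => \sum_(k < (N - j).+1) F i j k)).
under [RHS]eq_bigr do rewrite -(big_mkord xpredT).
rewrite [RHS]exchange_big_nat /= [RHS](big_nat_widen _ _ N.+1); last by lia.
by apply: eq_bigl => k /=; lia.
Qed.

Lemma wedge_identity {K : fieldType} (q x : K) (a : int -> K) N :
  (forall n, qpoch q q n != 0) -> (forall n, qpoch (- x) q n != 0) ->
  \sum_(j < N.+1) \sum_(i < (j + N).+1) qpoch q q N / qpoch q q (N - j) *
    (a (i%:Z - j%:Z) * q ^+ (j * j.-1)./2 * x ^+ j
      / (qpoch q q i * qpoch q q j))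
  = qpoch (- x) q N *
  \sum_(j < N.+1) \sum_(i < (j + N).+1) qpoch q q N / qpoch q q (N - j) *
    (a (i%:Z - j%:Z) * q ^+ ((j * j.-1)./2 + i * j) * x ^+ j
      / (qpoch q q i * qpoch q q j * qpoch (- x) q j)).
Proof.
move=> qN0 xN0.
(* Both sides expand into this summand: the left by q-Vandermonde at I = i + k, J = j + k, the right
   by Rothe's theorem with summation index k. *)
pose F i j k := qpoch q q N / qpoch q q (N - (j + k)) *
  (a (i%:Z - j%:Z) * q ^+ 'C(j + k, 2) * x ^+ (j + k)) *
  (q ^+ (i * j) / (qpoch q q i * qpoch q q j * qpoch q q k)).
transitivity (\sum_(J < N.+1) \sum_(I < (J + N).+1)
  \sum_(k < J.+1 | (k <= I)%N) F (I - k)%N (J - k)%N k).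
  apply: eq_bigr => J _; apply: eq_bigr => I _.
  rewrite -bin2 -(qVandermonde q qN0) !mulr_sumr; apply: eq_bigr => k le_kI.
  have le_kJ : (k <= J)%N by rewrite -ltnS.
  rewrite /F subnK //; have -> : (I - k)%:Z - (J - k)%:Z = I%:Z - J%:Z by lia.
  by rewrite !mulrA.
rewrite sum_wedge_shift mulr_sumr; apply: eq_bigr => -[j /= lt_jN] _.
rewrite mulr_sumr; apply: eq_bigr => i _.
(* The first factor cancels the denominator (-x)_j; the second is expanded by Rothe's theorem. *)
have -> : qpoch (- x) q N = qpoch (- x) q j * qpoch (- (x * q ^+ j)) q (N - j).
  by rewrite -mulNr -qpochD subnKC.
rewrite (qpoch_sum q (x * _)) mulr_sumr mulr_suml; apply: eq_bigr => k _.
have le_k : (k <= N - j)%N by rewrite -ltnS.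
(* The weight turns the q-binomial of N - j over k into (q)_N / ((q)_(N-j-k) (q)_k); the powers of q
   agree by [binD2]. *)
have := qN0 (N - j)%N; rewrite /F subnDA -(qbinom_qpoch _ _ _ le_k) -bin2.
rewrite binD2 !exprD exprMn -exprM !mulf_eq0 !negb_or => /and3P[b0 k0 Nk0].
by field; rewrite ?b0 ?k0 ?Nk0 ?qN0 ?xN0.
Qed.

(** * Completeness of the complex numbers *)

Section Convergence.
Local Open Scope classical_set_scope.

(* Completeness in a form that can be checked on real and imaginary parts by
   monotone convergence; A n plays the role of the partial sums of norms. *)
Definition dominated_complete (K : numFieldType) := forall (S A : nat -> K) M,
  (forall n, A n <= M) ->
  (forall m n, (m <= n)%N -> `|S n - S m| <= A n - A m) ->
  exists l : K, S @ \oo --> l.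

Lemma normc_le_Re_Im {R : rcfType} (z : R[i]) :
  `|z| <= (`|complex.Re z| + `|complex.Im z|)%:C%C.
Proof.
rewrite {1}[z]complexE (le_trans (ler_normD _ _)) // normrM.
rewrite rmorphD /= lerD //.
  by rewrite normc_def /= expr0n /= addr0 sqrtr_sqr.
rewrite !normc_def /= !expr0n /= !addr0 add0r expr1n sqrtr1 mul1r.
by rewrite sqrtr_sqr.
Qed.

Lemma complex_cvg {R : realType} (u : nat -> R[i]) (a b : R) :
  complex.Re (u n) @[n --> \oo] --> a -> complex.Im (u n) @[n --> \oo] --> b ->
  (u : nat -> (R[i] : numFieldType)) @ \oo -->
    ((a +i* b)%C : (R[i] : numFieldType)).
Proof.
move=> ua ub; apply/cvgrPdist_le => e e0.
(* The tolerance is itself an element of [R[i]]; being positive, it is real. *)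
have er : e = (complex.Re e)%:C%C by rewrite RRe_real // gtr0_real.
have e0' : 0 < complex.Re e by rewrite -ltcR -er.
have e2 : 0 < complex.Re e / 2 by rewrite divr_gt0.
near=> n.
apply: le_trans (normc_le_Re_Im _) _.
rewrite er lecR [leRHS]splitr.
have -> : (a +i* b)%C - u n = 
  ((a - complex.Re (u n)) +i* (b - complex.Im (u n)))%C by case: (u n).
by apply: lerD; near: n; exact: cvgr_dist_le.
Unshelve. all: by end_near. Qed.

Lemma Re_norm_le {R : rcfType} (z : R[i]) (e : R[i]) :
  `|z| <= e -> `|complex.Re z| <= complex.Re e /\ `|complex.Im z| <= complex.Re e.
Proof.
move=> ze; split.
  have := le_trans (normc_ge_Re z) ze; by rewrite lecE => /andP[].
have := normc_ge_Re (z * 'i%C).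
rewrite ReiNIm normrN normrM.
have -> : `|'i%C| = 1 :> R[i].
  by rewrite normc_def /= expr0n /= add0r expr1n sqrtr1.
by rewrite mulr1 => /le_trans/(_ ze); rewrite lecE => /andP[].
Qed.

(** Both [b] and [s + b] are nondecreasing and bounded above, so [s] is a difference of two
    convergent sequences. *)
Lemma real_dominated_cvg {R : realType} (s b : nat -> R) M :
  (forall n, b n <= M) ->
  (forall m n, (m <= n)%N -> `|s n - s m| <= b n - b m) ->
  exists l : R, s @ \oo --> l.
Proof.
move=> bM sb.
have b_nd m n : (m <= n)%N -> b m <= b n.
  by move=> /sb /(le_trans (normr_ge0 _)); rewrite subr_ge0.
have cb : cvgn b.
  by apply: nondecreasing_is_cvgn => //; exists M => _ [n _ <-].
have csb : cvgn (s \+ b).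
  apply: nondecreasing_is_cvgn => [m n /sb|].
    by rewrite ler_norml => /andP[+ _] /=; lra.
  exists (s 0 + (M - b 0) + M) => _ [n _ <-] /=.
  have := sb _ _ (leq0n n); rewrite ler_norml => /andP[_].
  have := bM n; lra.
exists (limn (s \+ b) - limn b).
have : (fun n => (s \+ b) n - b n) @ \oo --> limn (s \+ b) - limn b.
  exact: cvgB csb cb.
by under eq_fun do rewrite /= addrK.
Qed.

Lemma complex_dominated_complete (R : realType) :
  dominated_complete (R[i] : numFieldType).
Proof.
move=> S A M AM SA.
have [|m n mn|a ca] := @real_dominated_cvg R (fun n => complex.Re (S n))
  (fun n => complex.Re (A n)) (complex.Re M).
- by move=> n; have := AM n; rewrite lecE => /andP[].
- by have [+ _] := Re_norm_le _ _ (SA _ _ mn); rewrite !raddfB.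
have [|m n mn|b cb] := @real_dominated_cvg R (fun n => complex.Im (S n))
  (fun n => complex.Re (A n)) (complex.Re M).
- by move=> n; have := AM n; rewrite lecE => /andP[].
- by have [_] := Re_norm_le _ _ (SA _ _ mn); rewrite !raddfB.
by exists (a +i* b)%C; exact: complex_cvg.
Qed.

(** * Square partial sums and dominated convergence *)

Lemma square_sum_widen {V : nmodType} (F : nat -> nat -> V) m n : (m <= n)%N ->
  \sum_(i < m) \sum_(j < m) F i j
  = \sum_(i < n) \sum_(j < n) (if (i < m)%N && (j < m)%N then F i j else 0).
Proof.
move=> mn; rewrite (big_ord_widen n (fun i => \sum_(j < m) F i j) mn).
rewrite big_mkcond; apply: eq_bigr => i _ /=.
case: ifP => im; last by rewrite big1.
by rewrite (big_ord_widen n (F i) mn) big_mkcond.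
Qed.

(** After padding the smaller square with zeros, its terms cancel and each remaining term is at most
    [B * |f i j|]. *)
Lemma square_sum_tail_le {K : numFieldType} (w f : nat -> nat -> K) B m n :
  (m <= n)%N -> (forall i j, `|w i j| <= B) ->
  `|\sum_(i < n) \sum_(j < n) w i j * f i j
    - \sum_(i < m) \sum_(j < m) w i j * f i j|
  <= B * (\sum_(i < n) \sum_(j < n) `|f i j| - \sum_(i < m) \sum_(j < m) `|f i j|).
Proof.
move=> mn wB.
rewrite (square_sum_widen (fun i j => w i j * f i j) _ _ mn)
  (square_sum_widen (fun i j => `|f i j|) _ _ mn).
rewrite -!sumrB mulr_sumr (le_trans (ler_norm_sum _ _ _)) // ler_sum // => i _.
rewrite -!sumrB mulr_sumr (le_trans (ler_norm_sum _ _ _)) // ler_sum // => j _.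
case: ifP => _; first by rewrite !subrr normr0 mulr0.
by rewrite !subr0 normrM ler_wpM2r.
Qed.

Section Complete.
Context {K : numFieldType} (K_complete : dominated_complete K).

Lemma abs_summable2_cvg (f : nat -> nat -> K) : abs_summable2 f ->
  (fun n : nat => \sum_(i < n) \sum_(j < n) f i j) @ \oo --> dsum2 f.
Proof.
move=> [M fM].
have [|l cl] := K_complete (fun n => \sum_(i < n) \sum_(j < n) f i j) _ M fM.
  move=> m n mn; have := square_sum_tail_le (fun _ _ => 1) f 1 m n mn.
  rewrite mul1r; under eq_bigr do under eq_bigr do rewrite mul1r.
  under [X in _ - X]eq_bigr do under eq_bigr do rewrite mul1r.
  by apply=> *; rewrite normr1.
by rewrite /dsum2 (cvg_lim (@norm_hausdorff _ _) cl).
Qed.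

(* Tannery's theorem for double series *)
Lemma dsum2_dominated (f : nat -> nat -> K) (w : nat -> nat -> nat -> K)
    (g : nat -> nat) (B : K) :
  abs_summable2 f -> (forall n, (n <= g n)%N) ->
  (forall n i j, `|w n i j| <= B) ->
  (forall i j, w n i j @[n --> \oo] --> (1 : K)) ->
  (\sum_(i < g n) \sum_(j < g n) w n i j * f i j) @[n --> \oo] --> dsum2 f.
Proof.
move=> fs g_ge wB w1.
have cf := abs_summable2_cvg f fs.
have ca : (fun n : nat => \sum_(i < n) \sum_(j < n) `|f i j|) @ \oo -->
    dsum2 (fun i j => `|f i j|).
  apply: abs_summable2_cvg; case: fs => M fM; exists M => N.
  by under eq_bigr do under eq_bigr do rewrite normr_id.
have B0 : 0 <= B by apply: le_trans (wB 0 0 0)%N.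
apply/cvgrPdist_le => e e0.
have d0 : 0 < 1 + (B + B) by rewrite ltr_wpDr // addr_ge0.
(* Write d for this quantity. The final error is d + e/2 + B (d + d) = e. *)
have e1 : 0 < e / 2 / (1 + (B + B)) by rewrite !divr_gt0.
have [N1 _ H1] := cvgr_dist_le _ _ cf _ e1.
have [N2 _ H2] := cvgr_dist_le _ _ ca _ e1.
pose m := maxn N1 N2.
have cm : (\sum_(i < m) \sum_(j < m) w n i j * f i j) @[n --> \oo] -->
    \sum_(i < m) \sum_(j < m) f i j.
  apply: cvg_big => [|i _]; first exact: add_continuous.
  apply: cvg_big => [|j _]; first exact: add_continuous.
  by rewrite -[X in _ --> X]mul1r; apply: cvgMl.
near=> n.
have mn : (m <= g n)%N by apply: leq_trans (g_ge n); near: n; exists m.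
have /H1 m1 : (N1 <= m)%N by rewrite leq_maxl.
have /H2 m2 : (N2 <= m)%N by rewrite leq_maxr.
have /H2 m3 : (N2 <= g n)%N by rewrite (leq_trans _ mn) ?leq_maxr.
have m4 : `|\sum_(i < m) \sum_(j < m) f i j - 
    \sum_(i < m) \sum_(j < m) w n i j * f i j| <= e / 2.
  by near: n; apply: cvgr_dist_le cm _ _; rewrite divr_gt0.
have m5 := square_sum_tail_le (w n) f B m (g n) mn (wB n).
rewrite /= in m1 m2 m3.
set l := dsum2 f in m1 *; set la := dsum2 _ in m2 m3.
set Sm := (X in `|l - X|) in m1; set Am := (X in `|la - X|) in m2.
set Ag := (X in `|la - X|) in m3; set Tg := (X in `|l - X|).
rewrite -/Sm -/Am -/Ag in m4 m5; set Tm := (X in `|Sm - X|) in m4.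
have m6 : Ag - Am <= e / 2 / (1 + (B + B)) + e / 2 / (1 + (B + B)).
  apply: le_trans (real_ler_norm _) _.
    by rewrite realB //; apply: ger0_real; do 2!apply: sumr_ge0 => ? _.
  have -> : Ag - Am = (la - Am) - (la - Ag) by ring.
  by apply: le_trans (ler_normB _ _) _; exact: lerD.
(* The unweighted tail, the effect of the weights on the fixed square of side [m], and the weighted
   tail. *)
have -> : l - Tg = (l - Sm) + (Sm - Tm) - (Tg - Tm) by ring.
apply: le_trans (ler_normB _ _) _.
apply: le_trans (lerD (ler_normD _ _) m5) _.
apply: le_trans (lerD (lerD m1 m4) (ler_wpM2l B0 m6)) _.
rewrite le_eqVlt; apply/orP; left; apply/eqP; field.
by rewrite lt0r_neq0.
Unshelve. all: by end_near. Qed.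

(** * Limits and bounds of q-Pochhammer symbols *)

Lemma geometric_cvg0 (q : K) : `|q| < 1 -> q ^+ n @[n --> \oo] --> (0 : K).
Proof.
move=> q1.
(* The norms decrease, so their negatives serve as majorant, bounded by 0. The limit satisfies l =
   |q| l, hence vanishes. *)
have [n|m n mn|l cl] := K_complete (fun n => `|q| ^+ n) (fun n => - `|q| ^+ n) 0.
- by rewrite oppr_le0 exprn_ge0.
- rewrite opprK [leRHS]addrC distrC ger0_norm // subr_ge0.
  by apply: ler_wiXn2l => //; exact: ltW.
have l0 : l = 0.
  have c1 : (`|q| ^+ (n + 1)) @[n --> \oo] --> l.
    by rewrite (cvg_shiftn 1 (fun n => `|q| ^+ n)).
  have c2 : (`|q| ^+ (n + 1)) @[n --> \oo] --> `|q| * l.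
    by under eq_fun do rewrite addn1 exprS; apply: cvgMr.
  have /eqP : l = `|q| * l by exact: (cvg_unique (@norm_hausdorff K K^o) c1 c2).
  rewrite -subr_eq0 -[X in X - _]mul1r -mulrBl mulf_eq0 subr_eq0.
  by rewrite eq_sym lt_eqF //= => /eqP.
apply/norm_cvg0P; rewrite l0 in cl.
by under eq_fun do rewrite normrX.
Qed.

Lemma geometric_sum_le (t : K) n : 0 <= t < 1 ->
  \sum_(k < n) t ^+ k <= (1 - t)^-1.
Proof.
move=> /andP[t0 t1]; have t1' : 0 < 1 - t by rewrite subr_gt0.
rewrite -[leRHS]mul1r ler_pdivlMr // mulrC.
have := subrX1 t n => /(congr1 (fun x => - x)).
by rewrite -mulNr !opprB => <-; rewrite gerBl exprn_ge0.
Qed.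

(** Consecutive products differ by at most B |a| |q|^n, so geometric partial sums are a majorant. *)
Lemma qpoch_cvg (a q B : K) : `|q| < 1 -> (forall n, `|qpoch a q n| <= B) ->
  qpoch a q n @[n --> \oo] --> qpoch_inf a q.
Proof.
move=> q1 qB; have B0 : 0 <= B := le_trans (normr_ge0 _) (qB 0%N).
have [n|m n mn|l cl] := K_complete (qpoch a q)
    (fun n => B * `|a| * \sum_(k < n) `|q| ^+ k) (B * `|a| * (1 - `|q|)^-1).
- by rewrite ler_wpM2l ?mulr_ge0 // geometric_sum_le // normr_ge0.
- rewrite -(subnKC mn); elim: (n - m)%N => [|k IHk].
    by rewrite addn0 !subrr normr0.
  rewrite addnS qpochS big_ord_recr /= mulrBr mulr1 mulrDr.
  rewrite addrAC [leRHS]addrAC (le_trans (ler_normB _ _)) // lerD //.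
  by rewrite !normrM normrX mulrA !ler_wpM2r.
by rewrite /qpoch_inf (cvg_lim (@norm_hausdorff _ _) cl).
Qed.

Lemma qpoch_cvg1 (c : nat -> K) q J : c @ \oo --> (0 : K) ->
  qpoch (c n) q J @[n --> \oo] --> (1 : K).
Proof.
move=> c0; elim: J => [|J IHJ].
  by under eq_fun do rewrite /qpoch big_ord0; exact: cvg_cst.
under eq_fun do rewrite qpochS.
have cJ : (1 - c n * q ^+ J) @[n --> \oo] --> 1 - 0 * q ^+ J.
  by apply: cvgB; [exact: cvg_cst | exact: cvgMl].
by have := cvgM IHJ cJ; rewrite mul0r subr0 mulr1; apply.
Qed.
End Complete.

Lemma prod1Dgeom_le {R : realType} (r t : R) n : 0 <= r -> 0 <= t < 1 ->
  \prod_(k < n) (1 + r * t ^+ k) <= expR (r / (1 - t)).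
Proof.
move=> r0 t01; have [t0 _] := andP t01.
apply: le_trans (_ : expR (\sum_(k < n) r * t ^+ k) <= _).
  rewrite expR_sum; apply: ler_prod => k _.
  by rewrite expR_ge1Dx addr_ge0 // mulr_ge0 // exprn_ge0.
by rewrite ler_expR -mulr_sumr ler_wpM2l // geometric_sum_le.
Qed.

(** Uniformity in [a] allows the bound to cover the weights, whose parameter varies with N and j. It
    comes from 1 + y <= exp y. *)
Lemma qpoch_bounded {R : realType} (q r : R[i]) : `|q| < 1 ->
  exists B : R[i], forall (a : R[i]) n, `|a| <= r -> `|qpoch a q n| <= B.
Proof.
move=> q1; pose r' := complex.Re `|r|; pose t := complex.Re `|q|.
have rE : `|r| = r'%:C%C by rewrite RRe_real // normr_real.
have tE : `|q| = t%:C%C by rewrite RRe_real // normr_real.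
exists (expR (r' / (1 - t)))%:C%C => a n ar.
have r'0 : 0 <= r' by rewrite -ler0c -rE.
have t01 : 0 <= t < 1 by rewrite -ler0c -tE normr_ge0 -ltcR -tE.
apply: le_trans (_ : (\prod_(k < n) (1 + r' * t ^+ k))%:C%C <= _); last first.
  by rewrite lecR prod1Dgeom_le.
rewrite rmorph_prod normr_prod; apply: ler_prod => k _.
rewrite normr_ge0 /= rmorphD rmorph1 rmorphM rmorphXn /= -rE -tE.
rewrite (le_trans (ler_normB _ _)) // normr1 lerD2l normrM normrX.
by rewrite ler_wpM2r ?exprn_ge0 // (ger0_norm (le_trans _ ar)).
Qed.

Lemma qpoch_neq0 {K : numFieldType} (q : K) n : `|q| < 1 -> qpoch q q n != 0.
Proof.
move=> q1; apply/prodf_neq0 => k _; rewrite subr_eq0 -exprS.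
apply: contraTneq (q1) => q1'.
have : `|q ^+ k.+1| = 1 by rewrite -q1' normr1.
by rewrite normrX => /eqP; rewrite pexprn_eq1 // => /eqP ->; rewrite ltxx.
Qed.

(** * The weights, extended by zero outside the wedge *)

Definition wedge_weight {K : fieldType} (q : K) N i j :=
  if (j <= N)%N && (i <= j + N)%N then qpoch q q N / qpoch q q (N - j) else 0.

(** In this form the weight is visibly bounded, and tends to 1 for fixed j as q^(N-j) tends to 0. *)
Lemma wedge_weightE {K : numFieldType} (q : K) N i j : `|q| < 1 ->
  (j <= N)%N -> (i <= j + N)%N ->
  wedge_weight q N i j = qpoch (q * q ^+ (N - j)) q j.
Proof.
move=> q1 jN iN; rewrite /wedge_weight jN iN -{1}(subnK jN) qpochD mulrAC.
by rewrite mulfV ?mul1r // qpoch_neq0.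
Qed.

Lemma wedge_weight_cvg {K : numFieldType} (q : K) i j :
  dominated_complete K -> `|q| < 1 ->
  wedge_weight q N i j @[N --> \oo] --> (1 : K).
Proof.
move=> K_complete q1.
have c0 : (q * q ^+ (N - j)) @[N --> \oo] --> (0 : K).
  rewrite (cvg_centern j (fun n => q * q ^+ n)).
  have : (q * q ^+ n) @[n --> \oo] --> q * 0.
    by apply: cvgMr; exact: geometric_cvg0.
  by rewrite mulr0.
apply: cvg_trans (qpoch_cvg1 _ q j c0); apply: near_eq_cvg; near=> N.
have jN : (j <= N)%N by near: N; exists j.
have iN : (i <= N)%N by near: N; exists i.
by rewrite wedge_weightE // (leq_trans iN) // leq_addl.
Unshelve. all: by end_near. Qed.

(** On the wedge j <= N and i <= j + N <= 2N, so a square of side 2N + 1 contains it. *)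
Lemma wedge_weight_sum {K : fieldType} (q : K) (f : nat -> nat -> K) N :
  \sum_(i < N.*2.+1) \sum_(j < N.*2.+1) wedge_weight q N i j * f i j
  = \sum_(j < N.+1) \sum_(i < (j + N).+1)
      qpoch q q N / qpoch q q (N - j) * f i j.
Proof.
have le_N : (N.+1 <= N.*2.+1)%N by rewrite ltnS -addnn leq_addr.
rewrite exchange_big /= (big_ord_widen _ (fun j => \sum_(i < (j + N).+1)
  qpoch q q N / qpoch q q (N - j) * f i j) le_N) [RHS]big_mkcond.
apply: eq_bigr => j _; rewrite ltnS; case: ifP => jN; last first.
  by rewrite big1 // => i _; rewrite /wedge_weight jN mul0r.
have le_jN : ((j + N).+1 <= N.*2.+1)%N by move: jN; lia.
rewrite (big_ord_widen _ (fun i =>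
  qpoch q q N / qpoch q q (N - j) * f i j) le_jN) [RHS]big_mkcond.
apply: eq_bigr => i _; rewrite ltnS /wedge_weight jN /=.
by case: ifP => _ //; rewrite mul0r.
Qed.

End Convergence.

Theorem theorem1p1 (R : realType) (q x : R[i]) (a : int -> R[i]) :
  `|q| < 1 ->
  (forall j : nat, qpoch (- x) q j != 0) ->
  abs_summable2 (fun i j : nat =>
    a (i%:Z - j%:Z) * q ^+ (j * j.-1)./2 * x ^+ j / (qpoch q q i * qpoch q q j)) ->
  abs_summable2 (fun i j : nat =>
    a (i%:Z - j%:Z) * q ^+ ((j * j.-1)./2 + i * j) * x ^+ j
      / (qpoch q q i * qpoch q q j * qpoch (- x) q j)) ->
  dsum2 (fun i j : nat =>
    a (i%:Z - j%:Z) * q ^+ (j * j.-1)./2 * x ^+ j / (qpoch q q i * qpoch q q j))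
  = qpoch_inf (- x) q *
    dsum2 (fun i j : nat =>
      a (i%:Z - j%:Z) * q ^+ ((j * j.-1)./2 + i * j) * x ^+ j
        / (qpoch q q i * qpoch q q j * qpoch (- x) q j)).
Proof.
move=> q1 xN0; set fL := (fun i j => _); set fR := (fun i j => _) => sL sR.
pose K : numFieldType := R[i].
have K_complete : dominated_complete K := complex_dominated_complete R.
have [Bx Bx_le] := qpoch_bounded q `|x| q1.
(* Radius 1 suffices for the weights: their parameter q^(N-j+1) has norm at most 1. *)
have [Bq Bq_le] := qpoch_bounded q 1 q1.
have w_le N i j : `|wedge_weight (q : K) N i j| <= Bq.
  have Bq0 : 0 <= Bq by apply: le_trans (normr_ge0 _) (Bq_le 0 0%N _); rewrite normr0.
  case: (boolP ((j <= N)%N && (i <= j + N)%N)) => [/andP[jN iN]|/negPf].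
    rewrite wedge_weightE // Bq_le // -exprS normrX exprn_ile1 //.
    exact: ltW.
  by rewrite /wedge_weight => ->; rewrite normr0.
have double_ge n : (n <= n.*2.+1)%N by lia.
have cvgW (f : nat -> nat -> K) (fs : abs_summable2 f) :=
  dsum2_dominated K_complete f _ _ Bq fs double_ge w_le
   (fun i j => wedge_weight_cvg _ i j K_complete q1).
have cL := cvgW _ sL; have cR := cvgW _ sR.
have cx : (qpoch (- x : K) q n @[n --> \oo] --> qpoch_inf (- x : K) q)%classic.
  apply: (qpoch_cvg K_complete _ _ Bx q1) => n.
  by apply: Bx_le; rewrite normrN.
(* The finite identity for every N makes the two sequences equal, so their limits agree. *)
have eqLR : (fun N => \sum_(i < N.*2.+1) \sum_(j < N.*2.+1)
      wedge_weight (q : K) N i j * fL i j)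
    = (fun N => qpoch (- x : K) q N *
        \sum_(i < N.*2.+1) \sum_(j < N.*2.+1) wedge_weight q N i j * fR i j).
  apply/funext => N; rewrite !wedge_weight_sum.
  by apply: wedge_identity => // n; exact: qpoch_neq0.
rewrite eqLR in cL.
exact: (cvg_unique (@norm_hausdorff K K^o) cL (cvgM cx cR)).
Qed.
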